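(* Let $h\in C(Z\times E)$ be an integrand with linear growth at infinity. Then $$(h^\#)_{\mathcal A\text{-}\mathrm{hom}}(z)\ \ge\ (h_{\mathcal A\text{-}\mathrm{hom}})^\#(z)\qquad\text{for all }z\in E.$$
   Context: $Z=\mathbb T^d=\mathbb R^d/\mathbb Z^d$; $E,F$ are finite-dimensional Euclidean spaces. $\mathcal A=\sum_{|\alpha|=k}A_\alpha\partial^\alpha$, $A_\alpha\in\mathrm{Lin}(E;F)$, is a homogeneous constant-coefficient linear partial differential operator of order $k$ on $\mathbb R^d$. Linear growth at infinity: $|h(\xi,z)|\le M(1+|z|)$ for some $M>0$. Upper recession function: $h^\#(\xi,z)=\limsup_{\xi'\to\xi,\ t\to\infty}\frac{h(\xi',tz)}{t}$; for a function $g$ of $z$ only, $g^\#(z)=\limsup_{t\to\infty}\frac{g(tz)}t$. $\mathcal A$-free homogeneous envelope of an integrand $h:Z\times E\to\mathbb R$ (regarded as periodic in the first variable): $$h_{\mathcal A\text{-}\mathrm{hom}}(z)=\inf\Big\{\frac1{R^d}\int_{Q_R}h(y,z+w(y))\,dy\ :\ R\in\mathbb N,\ w\in C^\infty_{\mathrm{per}}(Q_R;E)\cap\ker\mathcal A,\ \int_{Q_R}w\,dy=0\Big\},$$ where $Q_R$ is a cube of side length $R$ with sides parallel to the axes and $C^\infty_{\mathrm{per}}(Q_R;E)$ are the smooth $Q_R$-periodic maps $\mathbb R^d\to E$; the same formula is used for $h^\#$ in place of $h$. Values $-\infty$ are allowed. *)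

(* Defs.v *)
From HB Require Import structures.
From mathcomp Require Import all_boot all_order all_algebra.
From mathcomp Require Import all_classical all_reals all_analysis.

Set Implicit Arguments.
Unset Strict Implicit.
Unset Printing Implicit Defensive.

Import Order.TTheory GRing.Theory Num.Theory.
Import numFieldNormedType.Exports.

Local Open Scope classical_set_scope.
Local Open Scope ring_scope.

(* Lebesgue measure on R^d, carried by [d.-tuple R] with its product (Borel)
   sigma-algebra: the d-fold product of [lebesgue_measure]. *)

Definition tcons (T : Type) (d : nat) (p : T * d.-tuple T) : d.+1.-tuple T :=
  [the d.+1.-tuple T of p.1 :: p.2].

Section lebesgue_tuple_succ.
Context (R : realType) (d : nat).
Local Notation RT := (measurableTypeR R).
Variable mu : {sigma_finite_measure set (d.-tuple RT) -> \bar R}.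

Lemma measurable_tcons : measurable_fun setT (@tcons RT d).
Proof. exact: (measurable_cons measurable_fst measurable_snd). Qed.

Definition leb_succ : set (d.+1.-tuple RT) -> \bar R :=
  pushforward (lebesgue_measure \x mu)%E (@tcons RT d).

Let leb_succ0 : leb_succ set0 = 0%E.
Proof. by rewrite /leb_succ /pushforward preimage_set0 measure0. Qed.

Let leb_succ_ge0 A : (0 <= leb_succ A)%E.
Proof. by rewrite /leb_succ /pushforward; exact: measure_ge0. Qed.

Let leb_succ_sigma_additive : semi_sigma_additive leb_succ.
Proof.
move=> F mF tF mUF; rewrite /leb_succ /pushforward preimage_bigcup.
have mpre A : measurable A -> measurable (@tcons RT d @^-1` A).
  by move=> mA; rewrite -[X in measurable X]setTI; exact: measurable_tcons.
apply: measure_semi_sigma_additive.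
- by move=> n; exact: mpre.
- apply/trivIsetP => /= i j _ _ ij; rewrite -preimage_setI.
  by move/trivIsetP : tF => /(_ _ _ _ _ ij) ->//; rewrite preimage_set0.
- by rewrite -preimage_bigcup; exact: mpre.
Qed.

HB.instance Definition _ := isMeasure.Build _ _ _
  leb_succ leb_succ0 leb_succ_ge0 leb_succ_sigma_additive.

Lemma leb_succX (A : set RT) (B : set (d.-tuple RT)) :
  measurable A -> measurable B ->
  leb_succ [set t | A (thead t) /\ B [tuple of behead t]] =
    (lebesgue_measure A * mu B)%E.
Proof.
move=> mA mB; rewrite -product_measure1E// /leb_succ /pushforward.
congr (_ _); apply/seteqP; split => -[x t] /=; rewrite theadE.
  by move=> [Ax Bt]; split => //=; congr B: Bt; exact: val_inj.
by move=> [Ax Bt]; split => //=; congr B: Bt; exact: val_inj.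
Qed.

Let leb_succ_sigma_finite : sigma_finite setT leb_succ.
Proof.
have /sigma_finiteP[F [TF ndF Foo]] := sigma_finiteT (@lebesgue_measure R).
have /sigma_finiteP[G [TG ndG Goo]] := sigma_finiteT mu.
exists (fun n => [set t | F n (thead t) /\ G n [tuple of behead t]]).
  apply/seteqP; split => // t _.
  have : setT (thead t) by []. rewrite TF => -[n _ Fn].
  have : setT [tuple of behead t] by []. rewrite TG => -[k _ Gk].
  exists (maxn n k) => //; split.
    by move: Fn; exact/subsetPset/ndF/leq_maxl.
  by move: Gk; exact/subsetPset/ndG/leq_maxr.
move=> n; have [mF Fn] := Foo n; have [mG Gn] := Goo n; split.
  apply: measurableI; rewrite -[X in measurable X]setTI.
    exact: (measurable_tnth ord0).
  exact: measurable_behead.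
by rewrite leb_succX// lte_mul_pinfty// ge0_fin_numE.
Qed.

HB.instance Definition _ := Measure_isSigmaFinite.Build _ _ _
  leb_succ leb_succ_sigma_finite.

End lebesgue_tuple_succ.

Fixpoint leb (R : realType) (d : nat) :
    {sigma_finite_measure set (d.-tuple (measurableTypeR R)) -> \bar R} :=
  match d with
  | 0 => dirac ([tuple] : 0.-tuple (measurableTypeR R))
  | d'.+1 => leb_succ (leb R d')
  end.

Lemma leb_box (R : realType) (d : nat) (A : 'I_d -> set (measurableTypeR R)) :
  (forall i, measurable (A i)) ->
  leb R d [set t | forall i, A i (tnth t i)] =
    (\prod_(i < d) lebesgue_measure (A i))%E.
Proof.
elim: d A => [|d IH] A mA /=.
  by rewrite big_ord0 diracE mem_set// => -[].
rewrite big_ord_recl -IH//.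
set B := [set t : d.-tuple _ | _].
have mB : measurable B.
  rewrite (_ : B = \bigcap_(i : 'I_d) ((@tnth _ _ ^~ i) @^-1` A (lift ord0 i))).
    apply: fin_bigcap_measurable => // i _; rewrite -[X in measurable X]setTI.
    exact: measurable_tnth.
  by apply/seteqP; split => [t Bt i _|t Bt i]; exact: Bt.
rewrite -product_measure1E// /leb_succ /pushforward.
congr (_ _); apply/seteqP; split => -[x t] /=.
  move=> At; split; first exact: (At ord0).
  by move=> i /=; have := At (lift ord0 i); rewrite tnthS.
move=> [Ax Bt] i; case: (unliftP ord0 i) => [j ->|->].
  by rewrite tnthS; exact: Bt.
exact: Ax.
Qed.

Section integrands.
Context (R : realType).

Definition enorm (m : nat) (z : 'cV[R]_m) : R :=
  Num.sqrt (\sum_(i < m) z i 0 ^+ 2).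

Definition rV_of_tuple (d : nat) (t : d.-tuple (measurableTypeR R)) : 'rV[R]_d :=
  \row_(i < d) tnth t i.

Definition cube (d : nat) (a : 'rV[R]_d) (N : nat) :
    set (d.-tuple (measurableTypeR R)) :=
  [set t | forall i, a 0 i <= tnth t i <= a 0 i + N%:R].

Definition integral_cube (d : nat) (a : 'rV[R]_d) (N : nat)
    (f : 'rV[R]_d -> \bar R) : \bar R :=
  (\int[leb R d]_(t in cube a N) f (rV_of_tuple t))%E.

Definition lattice_periodic (d : nat) (T : Type) (N : nat) (f : 'rV[R]_d -> T) : Prop :=
  forall (y : 'rV[R]_d) (i : 'I_d), f (y + N%:R *: delta_mx 0 i) = f y.

Definition partial (d m : nat) (i : 'I_d) (w : 'rV[R]_d -> 'cV[R]_m) :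
    'rV[R]_d -> 'cV[R]_m :=
  fun y => 'D_(delta_mx 0 i) w y.

Definition partials (d m : nat) (s : seq 'I_d) (w : 'rV[R]_d -> 'cV[R]_m) :
    'rV[R]_d -> 'cV[R]_m :=
  foldr (@partial d m) w s.

(* C^infty: all iterated partial derivatives exist and are continuous. *)
Definition smooth (d m : nat) (w : 'rV[R]_d -> 'cV[R]_m) : Prop :=
  forall s : seq 'I_d, continuous (partials s w) /\
    forall (i : 'I_d) (y : 'rV[R]_d),
      derivable (partials s w) y (delta_mx 0 i).

(* Only the coefficients [A alpha] with |alpha| = k are used by [diffop];
   every such multi-index has entries at most k. *)
Definition mindex (d k : nat) := {ffun 'I_d -> 'I_k.+1}.

Definition mpartial (d k m : nat) (alpha : mindex d k)
    (w : 'rV[R]_d -> 'cV[R]_m) : 'rV[R]_d -> 'cV[R]_m :=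
  partials (flatten [seq nseq (alpha i) i | i <- enum 'I_d]) w.

Definition diffop (d k m n : nat) (A : mindex d k -> 'M[R]_(n, m))
    (w : 'rV[R]_d -> 'cV[R]_m) : 'rV[R]_d -> 'cV[R]_n :=
  fun y => \sum_(alpha : mindex d k | (\sum_(i < d) alpha i == k)%N)
    A alpha *m mpartial alpha w y.

(* The values may be infinite a priori; they are finite under linear growth. *)
Definition rec_xz (d m : nat) (h : 'rV[R]_d -> 'cV[R]_m -> R)
    (xi : 'rV[R]_d) (z : 'cV[R]_m) : \bar R :=
  limf_esup (fun p : 'rV[R]_d * R => (h p.1 (p.2 *: z) / p.2)%:E)
    (filter_prod (nbhs xi) (pinfty_nbhs R)).

Definition rec_z (m : nat) (g : 'cV[R]_m -> \bar R) (z : 'cV[R]_m) : \bar R :=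
  limf_esup (fun t : R => g (t *: z)%R * (t^-1)%R%:E)%E (pinfty_nbhs R).

(* Q_N is the cube of side N with lower corner [c N]; the position of the
   cubes is left arbitrary. The last condition says that w has mean zero,
   componentwise. *)
Definition test_field (d k m n : nat) (A : mindex d k -> 'M[R]_(n, m))
    (c : nat -> 'rV[R]_d) (N : nat) (w : 'rV[R]_d -> 'cV[R]_m) : Prop :=
  [/\ smooth w, lattice_periodic N w, (forall y, diffop A w y = 0) &
      forall i : 'I_m, integral_cube (c N) N (fun y => (w y i 0)%:E) = 0%E].

Definition Ahom (d k m n : nat) (A : mindex d k -> 'M[R]_(n, m))
    (c : nat -> 'rV[R]_d) (g : 'rV[R]_d -> 'cV[R]_m -> \bar R)
    (z : 'cV[R]_m) : \bar R :=
  ereal_inf [set v | exists (N : nat) (w : 'rV[R]_d -> 'cV[R]_m),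
    [/\ (0 < N)%N, test_field A c N w &
        v = (((N%:R ^+ d)^-1)%R%:E *
             integral_cube (c N) N (fun y => g y (z + w y)%R))%E]].

End integrands.

(* Main.v *)
(** For a test field w and t > 0, the field t w is again a test field, so
    h_{A-hom}(t z) / t is at most the mean over the cube of
    f_t(y) = h(y, t (z + w(y))) / t.  Choose t_j -> oo along which the left-hand
    side stays above a given number below its limsup.  Linear growth bounds the
    f_{t_j} uniformly, as w is bounded on the cube, so the reverse Fatou lemma
    moves the limsup inside the mean, where it is pointwise at most
    h^#(y, z + w(y)). *)

Require Import Defs.
From HB Require Import structures.
From mathcomp Require Import all_boot all_order all_algebra.
From mathcomp Require Import all_classical all_reals all_analysis.
From mathcomp Require Import measurable_realfun.
Import Order.TTheory GRing.Theory Num.Theory.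
Import numFieldNormedType.Exports.
Local Open Scope classical_set_scope.
Local Open Scope ring_scope.

(* No measurability is required, since the integral of a nonnegative function is
   a supremum over the simple functions below it; this spares us the
   measurability of h^#. *)
Lemma le_integral_pointwise d (T : measurableType d) (R : realType)
  (mu : {measure set T -> \bar R}) (D : set T) (f g : T -> \bar R) :
  (forall x, D x -> (f x <= g x)%E) ->
  (\int[mu]_(x in D) f x <= \int[mu]_(x in D) g x)%E.
Proof.
move=> fg; have le_patch x : ((f \_ D) x <= (g \_ D) x)%E.
  by rewrite /patch; case: ifPn => // /set_mem/fg.
rewrite /integral; apply: leeB; apply: ereal_sup_le => _ [s /= sle <-];
  exists s => // x; apply: le_trans (sle x) _.
- by apply: (@funepos_le _ _ setT _ _ (fun x _ => le_patch x)); rewrite inE.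
- by apply: (@funeneg_le _ _ setT _ _ (fun x _ => le_patch x)); rewrite inE.
Qed.

Lemma limn_esupDr (R : realType) (u : (\bar R)^nat) (c : R) :
  limn_esup (fun n => u n + c%:E)%E = (limn_esup u + c%:E)%E.
Proof.
have le_shift (v : (\bar R)^nat) (b : R) :
    (limn_esup (fun n => v n + b%:E) <= limn_esup v + b%:E)%E.
  rewrite -leeBlDr//; apply: le_ereal_inf_tmp => _ [V oV <-].
  rewrite leeBlDr//; apply: (@le_trans _ _
    (ereal_sup [set (v n + b%:E)%E | n in V])).
    by apply: ereal_inf_lbound; exists V.
  apply: ge_ereal_sup => _ [n Vn <-]; rewrite leeD2r//.
  by apply: ereal_sup_ubound; exists n.
apply/eqP; rewrite eq_le le_shift /=.
have := le_shift (fun n => u n + c%:E)%E (- c).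
under [X in limn_esup X]funext do rewrite EFinN addeK//.
by rewrite EFinN leeBrDr.
Qed.

Lemma limn_einfBl (R : realType) (u : (\bar R)^nat) (c : R) :
  limn_einf (fun n => c%:E - u n)%E = (c%:E - limn_esup u)%E.
Proof.
rewrite /limn_einf; have -> : (\- (fun n => c%:E - u n))%E = (fun n => u n + (- c)%:E)%E.
  by apply/funext => n; rewrite addeC fin_num_oppeD// oppeK.
by rewrite limn_esupDr EFinN fin_num_oppeB// addeC.
Qed.

Lemma reverse_fatou d (T : measurableType d) (R : realType)
  (mu : {measure set T -> \bar R}) (D : set T) (f : nat -> T -> R) (C : R) :
  measurable D -> (mu D < +oo)%E -> (forall n, measurable_fun D (f n)) ->
  0 <= C -> (forall n x, D x -> `|f n x| <= C) ->
  (limn_esup (fun n => \int[mu]_(x in D) (f n x)%:E) <=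
   \int[mu]_(x in D) limn_esup (fun n => (f n x)%:E))%E.
Proof.
move=> mD muD mf C0 fC.
have bounded_int (g : T -> \bar R) : measurable_fun D g ->
    (forall x, D x -> (`|g x| <= C%:E)%E) -> mu.-integrable D g.
  move=> mg gC; apply/integrableP; split => //.
  apply: (@le_lt_trans _ _ (\int[mu]_(x in D) C%:E)%E).
    exact: le_integral_pointwise.
  by rewrite integral_cst// lte_mul_pinfty.
have intC : mu.-integrable D (cst C%:E).
  by apply: bounded_int => // x _; rewrite /= ger0_norm.
have intf n : mu.-integrable D (fun x => (f n x)%:E).
  apply: bounded_int; first exact/measurable_EFinP.
  by move=> x Dx; rewrite lee_fin fC.
have intF : mu.-integrable D (fun x => limn_esup (fun n => (f n x)%:E)).
  apply: bounded_int.
    by apply: measurable_fun_limn_esup => n; exact/measurable_EFinP.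
  have abse_le (y : \bar R) : (- C%:E <= y -> y <= C%:E -> `|y| <= C%:E)%E.
    by case: y => [r| |] //; rewrite -EFinN !lee_fin ler_norml => -> ->.
  move=> x Dx; apply: abse_le.
    apply: le_ereal_inf_tmp => _ [V oV <-].
    have [n Vn] := filter_ex oV.
    apply: (@le_trans _ _ (f n x)%:E).
      by rewrite -EFinN lee_fin; have := fC n x Dx; rewrite ler_norml => /andP[].
    by apply: ereal_sup_ubound; exists n.
  apply: (@le_trans _ _ (ereal_sup [set (f n x)%:E | n in setT])).
    by apply: ereal_inf_lbound; exists setT => //; exact: filterT.
  apply: ge_ereal_sup => _ [n _ <-].
  by rewrite lee_fin; have := fC n x Dx; rewrite ler_norml => /andP[].
have Cfin : (\int[mu]_(x in D) cst C%:E x)%E \is a fin_num.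
  exact: integrable_fin_num.
have intB (g : T -> \bar R) : mu.-integrable D g ->
    (\int[mu]_(x in D) (C%:E - g x) =
     \int[mu]_(x in D) cst C%:E x - \int[mu]_(x in D) g x)%E.
  by move=> intg; rewrite -(integralB mD intC intg).
have : (\int[mu]_(x in D) limn_einf (fun n => C%:E - (f n x)%:E) <=
    limn_einf (fun n => \int[mu]_(x in D) (C%:E - (f n x)%:E)))%E.
  apply: fatou => // [n|n x Dx].
    by apply: emeasurable_funB => //; exact/measurable_EFinP.
  rewrite -EFinB lee_fin subr_ge0.
  by have := fC n x Dx; rewrite ler_norml => /andP[].
rewrite (eq_integral (fun x => C%:E - limn_esup (fun n => (f n x)%:E))%E);
  last by move=> x _; rewrite limn_einfBl.
rewrite (intB _ intF) (funext (fun n => intB _ (intf n))).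
by rewrite -(fineK Cfin) limn_einfBl leeD2lE// leeN2.
Qed.

Lemma measurable_tuple_box d (T : measurableType d) (n : nat)
  (A : 'I_n -> set T) : (forall i, measurable (A i)) ->
  measurable [set t : n.-tuple T | forall i, A i (tnth t i)].
Proof.
move=> mA; rewrite (_ : mkset _ = \bigcap_(i : 'I_n) ((@tnth _ _ ^~ i) @^-1` A i)).
  apply: fin_bigcap_measurable => // i _; rewrite -[X in measurable X]setTI.
  exact: measurable_tnth.
by apply/seteqP; split => [t At i _|t At i]; exact: At.
Qed.

Lemma measurable_preimage_open (R : realType) (d : nat) (U : set 'rV[R]_d) :
  open U -> measurable (@rV_of_tuple R d @^-1` U).
Proof.
move=> oU; set V := _ @^-1` U.
(* Boxes with rational centres form a countable base of the topology. *)
pose box (p : d.-tuple rat * nat) : set (d.-tuple (measurableTypeR R)) :=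
  [set t | forall i, ball (ratr (tnth p.1 i) : R) p.2.+1%:R^-1 (tnth t i)].
have mbox p : measurable (box p).
  apply: (@measurable_tuple_box _ _ _
    (fun i => ball (ratr (tnth p.1 i) : R) p.2.+1%:R^-1)) => i.
  exact: measurable_ball.
rewrite (_ : V = \bigcup_p (box p `&` [set _ | box p `<=` V])).
  apply: countable_bigcupT_measurable => // p; apply: measurableI => //.
  have [pV|pV] := pselect (box p `<=` V).
    by rewrite (_ : mkset _ = setT)//; apply/seteqP; split.
  by rewrite (_ : mkset _ = set0)//; apply/seteqP; split.
apply/seteqP; split => [t Vt|t [p _ [pt]]]; last exact.
have /nbhs_ballP[e /= e0 eU] : nbhs (rV_of_tuple t) U by exact: open_nbhs_nbhs.
have [n ne] : exists n, n.+1%:R^-1 < e / 2.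
  have /ltr_add_invr[n] : 0 < e / 2 by rewrite divr_gt0.
  by rewrite add0r; exists n.
have /choice[q tq] i : exists q : rat,
    `|ratr q - tnth t i| < n.+1%:R^-1.
  have [|q] := @rat_in_itvoo R (tnth t i - n.+1%:R^-1) (tnth t i + n.+1%:R^-1).
    by rewrite ltrBlDr -addrA ltrDl addr_gt0// invr_gt0.
  by rewrite in_itv /= => qt; exists q; rewrite ltr_distl.
exists ([tuple q i | i < d], n) => //; split.
  by move=> i /=; rewrite tnth_mktuple; exact: tq.
move=> s sbox; apply: eU; split => // i j; rewrite !mxE.
have := sbox j; rewrite /= tnth_mktuple /ball /= => sj.
rewrite (splitr e); apply: le_lt_trans (ler_distD (ratr (q j)) _ _) _.
by rewrite ltrD ?(lt_trans _ ne)// distrC.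
Qed.

Lemma measurable_continuous_tuple (R : realType) (d : nat) (f : 'rV[R]_d -> R) :
  continuous f -> measurable_fun setT
    ((fun t => f (rV_of_tuple t)) : d.-tuple (measurableTypeR R) -> R).
Proof.
move=> cf; apply: (measurability _ (RGenOInfty.measurableE R)) => _ [_ [x ->] <-].
rewrite setTI.
have : open (f @^-1` `]x, +oo[%classic).
  by move/continuousP : cf; apply; rewrite set_itvoy; exact: open_gt.
exact: measurable_preimage_open.
Qed.

Lemma cubeE (R : realType) (d : nat) (a : 'rV[R]_d) (N : nat) :
  cube a N = [set t | forall i, `[a 0 i, a 0 i + N%:R]%classic (tnth t i)].
Proof. by apply/seteqP; split => t at_ i; have := at_ i; rewrite /= in_itv. Qed.

Lemma measurable_cube (R : realType) (d : nat) (a : 'rV[R]_d) (N : nat) :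
  measurable (cube a N).
Proof.
rewrite cubeE; apply: (@measurable_tuple_box _ _ _
  (fun i => `[a 0 i, a 0 i + N%:R]%classic)) => i.
exact: measurable_itv.
Qed.

Lemma leb_cube_lty (R : realType) (d : nat) (a : 'rV[R]_d) (N : nat) :
  (leb R d (cube a N) < +oo)%E.
Proof.
rewrite cubeE (@leb_box _ _ (fun i => `[a 0 i, a 0 i + N%:R]%classic))//.
rewrite ltey_eq; apply/orP; left.
apply: (big_ind (fun x : \bar R => x \is a fin_num)) => // [x y|i _].
  exact: fin_numM.
by rewrite lebesgue_measure_itv /=; case: ifP.
Qed.

Lemma continuous_cube_bounded (R : realType) (d : nat) (a : 'rV[R]_d) (N : nat)
  (g : 'rV[R]_d -> R) : continuous g ->
  exists2 K, 0 <= K & forall t, cube a N t -> `|g (rV_of_tuple t)| <= K.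
Proof.
move=> cg.
have cptQ := @rV_compact R d (fun i => `[a 0 i, a 0 i + N%:R]%classic)
  (fun i => @segment_compact _ _ _).
have /compact_bounded[M [_ gM]] : compact (g @` [set v : 'rV[R]_d |
    forall i, `[a 0 i, a 0 i + N%:R]%classic (v ord0 i)]).
  by apply: continuous_compact cptQ; exact: continuous_subspaceT.
exists (`|M| + 1) => [|t]; first by rewrite addr_ge0.
rewrite cubeE => at_; apply: gM; first by rewrite ltr_pwDr// ler_norm.
by exists (rV_of_tuple t) => // i; rewrite mxE.
Qed.

Lemma continuous_cube_integrable (R : realType) (d : nat) (a : 'rV[R]_d)
  (N : nat) (g : 'rV[R]_d -> R) : continuous g ->
  (leb R d).-integrable (cube a N) (fun t => (g (rV_of_tuple t))%:E).
Proof.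
move=> cg; apply: measurable_bounded_integrable.
- exact: measurable_cube.
- exact: leb_cube_lty.
- by apply: measurable_funTS; exact: measurable_continuous_tuple.
- have [K _ gK] := continuous_cube_bounded _ _ a N _ cg.
  exists K; split => [|x Kx t at_]; first exact: num_real.
  by apply: le_trans (gK _ at_) _; exact: ltW.
Qed.

Lemma partials_scale (R : realType) (d m : nat) (r : R)
  (w : 'rV[R]_d -> 'cV[R]_m) (s : seq 'I_d) : smooth w ->
  partials s (r \*: w) = r \*: partials s w.
Proof.
move=> sw; elim: s => [//|i s IH]; apply/funext => y.
by rewrite /= IH /partial deriveZ//; exact: (sw s).2.
Qed.

Lemma smooth_scale (R : realType) (d m : nat) (r : R)
  (w : 'rV[R]_d -> 'cV[R]_m) : smooth w -> smooth (r \*: w).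
Proof.
move=> sw s; rewrite partials_scale//; split => [y|i y].
  by apply: continuous_comp; [exact: (sw s).1|exact: scaler_continuous].
by apply: derivableZ; exact: (sw s).2.
Qed.

Lemma diffop_scale (R : realType) (d k m n : nat) (A : mindex d k -> 'M[R]_(n, m))
  (r : R) (w : 'rV[R]_d -> 'cV[R]_m) (y : 'rV[R]_d) : smooth w ->
  diffop A (r \*: w) y = r *: diffop A w y.
Proof.
move=> sw; rewrite /diffop scaler_sumr; apply: eq_bigr => alpha _.
by rewrite /mpartial partials_scale// scalemxAr.
Qed.

Lemma test_field_scale (R : realType) (d k m n : nat)
  (A : mindex d k -> 'M[R]_(n, m)) (c : nat -> 'rV[R]_d) (N : nat) (r : R)
  (w : 'rV[R]_d -> 'cV[R]_m) :
  test_field A c N w -> test_field A c N (r \*: w).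
Proof.
move=> [sw pw Aw w0]; split.
- exact: smooth_scale.
- by move=> y i /=; rewrite pw.
- by move=> y; rewrite diffop_scale// Aw scaler0.
- move=> i; rewrite /integral_cube.
  under eq_integral do rewrite /= mxE EFinM.
  rewrite integralZl; first by rewrite [X in (_ * X)%E]w0 mule0.
    exact: measurable_cube.
  apply: (@continuous_cube_integrable _ _ _ _ (fun y => w y i 0)) => y.
  apply: (@continuous_comp _ _ _ w (fun v : 'cV[R]_m => v i 0)).
    exact: (sw [::]).1.
  exact: coord_continuous.
Qed.

Lemma enormZ (R : realType) (m : nat) (r : R) (z : 'cV[R]_m) :
  0 <= r -> enorm (r *: z) = r * enorm z.
Proof.
move=> r0; rewrite /enorm -[in RHS](ger0_norm r0) -sqrtr_sqr -sqrtrM ?sqr_ge0//.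
by rewrite mulr_sumr; congr Num.sqrt; apply: eq_bigr => i _; rewrite mxE exprMn.
Qed.

Lemma enorm_continuous (R : realType) (m : nat) : continuous (@enorm R m).
Proof.
have coord2 i : continuous (fun v : 'cV[R]_m => v i 0 ^+ 2).
  move=> z; apply: (@continuous_comp _ _ _
    (fun v : 'cV[R]_m => v i 0) (fun x : R => x ^+ 2)).
    exact: coord_continuous.
  exact: exprn_continuous.
have csum (s : seq 'I_m) :
    continuous (fun v : 'cV[R]_m => \sum_(i <- s) v i 0 ^+ 2).
  elim: s => [|i s IH].
    by under eq_fun do rewrite big_nil; exact: cst_continuous.
  under eq_fun do rewrite big_cons.
  move=> z; exact: (@continuousD R R^o _ (fun v : 'cV[R]_m => v i 0 ^+ 2)
    (fun v : 'cV[R]_m => \sum_(j <- s) v j 0 ^+ 2) z (coord2 i z) (IH z)).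
move=> z; apply: (@continuous_comp _ _ _
  (fun v : 'cV[R]_m => \sum_(i < m) v i 0 ^+ 2) Num.sqrt); first exact: csum.
exact: sqrt_continuous.
Qed.

Lemma limn_esup_comp_le (R : realType) (T : choiceType) (X : filteredType T)
  (f : X -> \bar R) (F : set_system X) (u : nat -> X) : u @ \oo --> F ->
  (limn_esup (f \o u) <= limf_esup f F)%E.
Proof.
move=> uF; apply: le_ereal_inf_tmp => _ [V FV <-].
apply: (@le_trans _ _ (ereal_sup ((f \o u) @` (u @^-1` V)))).
  by apply: ereal_inf_lbound; exists (u @^-1` V) => //; exact: uF.
by apply: ereal_sup_le => _ [n Vun <-]; exists (u n).
Qed.

Lemma le_ereal_dense (R : realType) (x y : \bar R) :
  (forall r : R, (r%:E < x)%E -> (r%:E <= y)%E) -> (x <= y)%E.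
Proof.
move=> xy; rewrite leNgt; apply/negP => yx.
suff [r yr rx] : exists2 r : R, (y < r%:E)%E & (r%:E < x)%E.
  by have := xy r rx; rewrite leNgt yr.
case: x y {xy} yx => [x| |] [y| |] //= yx.
- by exists ((y + x) / 2); rewrite lte_fin ?midf_lt//; rewrite lte_fin in yx.
- by exists (x - 1); rewrite ?ltNyr// lte_fin ltrBlDr ltrDl.
- by exists (y + 1); rewrite ?ltry// lte_fin ltrDl.
- by exists 0; rewrite ?ltNyr ?ltry.
Qed.

Lemma continuous_integrand_comp (R : realType) (d m : nat)
  (h : 'rV[R]_d -> 'cV[R]_m -> R) (v : 'rV[R]_d -> 'cV[R]_m) :
  continuous (fun p : 'rV[R]_d * 'cV[R]_m => h p.1 p.2) -> continuous v ->
  continuous (fun y => h y (v y)).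
Proof.
move=> ch cv y.
apply: (@continuous_comp _ _ _ (fun y => (y, v y)) (fun p => h p.1 p.2)).
  exact: (cvg_pair cvg_id (cv y)).
exact: ch.
Qed.

Lemma Ahom_rescaled_le (R : realType) (d k m n : nat)
  (A : mindex d k -> 'M[R]_(n, m)) (c : nat -> 'rV[R]_d)
  (h : 'rV[R]_d -> 'cV[R]_m -> R)
  (h_continuous : continuous (fun p : 'rV[R]_d * 'cV[R]_m => h p.1 p.2))
  (z : 'cV[R]_m) (N : nat) (w : 'rV[R]_d -> 'cV[R]_m) (t : R) :
  (0 < N)%N -> test_field A c N w -> 0 < t ->
  (Ahom A c (fun y v => (h y v)%:E) (t *: z) * (t^-1)%:E <=
   ((N%:R ^+ d)^-1)%:E *
     integral_cube (c N) N (fun y => (h y (t *: (z + w y)) / t)%:E))%E.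
Proof.
move=> N0 tw t0; apply: (@le_trans _ _ (((N%:R ^+ d)^-1)%:E *
    integral_cube (c N) N (fun y => (h y (t *: z + t *: w y))%:E) * (t^-1)%:E)%E).
  apply: lee_wpmul2r; first by rewrite lee_fin invr_ge0 ltW.
  apply: ereal_inf_lbound.
  by exists N, (t \*: w); split => //; exact: test_field_scale.
rewrite -muleA [(_ * t^-1%:E)%E]muleC /integral_cube -integralZl//.
- under eq_integral do rewrite -EFinM mulrC -scalerDr.
  exact: lexx.
- exact: measurable_cube.
- apply: (@continuous_cube_integrable _ _ _ _
    (fun y => h y (t *: z + t *: w y))).
  apply: continuous_integrand_comp => // y.
  apply: (@continuousD _ _ _ (cst (t *: z)) (t \*: w)); first exact: cst_continuous.
  apply: continuous_comp; last exact: scaler_continuous.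
  by have [sw _ _ _] := tw; exact: (sw [::]).1.
Qed.

Theorem proposition5p7 (R : realType) (d k m n : nat)
  (A : mindex d k -> 'M[R]_(n, m)) (c : nat -> 'rV[R]_d)
  (h : 'rV[R]_d -> 'cV[R]_m -> R)
  (h_periodic : lattice_periodic 1%N h)
  (h_continuous : continuous (fun p : 'rV[R]_d * 'cV[R]_m => h p.1 p.2))
  (h_growth : exists2 M : R, 0 < M &
    forall xi z, `|h xi z| <= M * (1 + enorm z)) :
  forall z : 'cV[R]_m,
    (rec_z (Ahom A c (fun xi v => (h xi v)%:E)) z <= Ahom A c (rec_xz h) z)%E.
Proof.
move=> z; have [M M0 hM] := h_growth.
apply: le_ereal_inf_tmp => _ [N [w [N0 tw ->]]].
have [/(_ [::])[/= cw _] _ _ _] := tw.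
apply: le_ereal_dense => a a_lt.
have /choice[t tP] j : exists s : R, j.+1%:R <= s /\
    (a%:E < Ahom A c (fun y v => (h y v)%:E) (s *: z) * (s^-1)%:E)%E.
  have : (a%:E < ereal_sup
      [set (Ahom A c (fun y v => (h y v)%:E) (s *: z) * (s^-1)%:E)%E |
       s in [set s : R | (j.+1%:R <= s)%R]])%E.
    apply: lt_le_trans a_lt (ereal_inf_lbound _).
    exists [set s : R | j.+1%:R <= s] => //.
    by exists j.+1%:R; split; [exact: num_real|move=> s /ltW].
  by move/ereal_sup_gt => [_ [s js <-] as_]; exists s.
have t_ge1 j : 1 <= t j.
  by apply: le_trans (tP j).1; rewrite ler1n.
have t_oo : t @ \oo --> +oo.
  apply/cvgryPge => x; near=> j.
  apply: (@le_trans _ _ j%:R); first by near: j; exact: nbhs_infty_ger.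
  by apply: le_trans (tP j).1; rewrite ler_nat.
have t_gt0 j : 0 < t j by apply: lt_le_trans (t_ge1 j).
pose v y := z + w y.
have cv : continuous v.
  move=> y; apply: (@continuousD _ _ _ (cst z) w); first exact: cst_continuous.
  exact: cw.
have [K K0 vK] : exists2 K, 0 <= K &
    forall s, cube (c N) N s -> `|enorm (v (rV_of_tuple s))| <= K.
  apply: (@continuous_cube_bounded _ _ _ _ (fun y => enorm (v y))) => y.
  by apply: continuous_comp; [exact: cv|exact: enorm_continuous].
pose f j s := h (rV_of_tuple s) (t j *: v (rV_of_tuple s)) / t j.
have mf j : measurable_fun (cube (c N) N) (f j).
  apply: measurable_funTS.
  apply: (@measurable_continuous_tuple _ _ (fun y => h y (t j *: v y) / t j)) => y.
  apply: (@continuous_comp _ _ _ (fun y => h y (t j *: v y)) (fun x : R => x / t j)).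
    apply: continuous_integrand_comp => // x.
    by apply: continuous_comp; [exact: cv|exact: scaler_continuous].
  exact: mulrr_continuous.
have fC j s : cube (c N) N s -> `|f j s| <= M * (1 + K).
  move=> Qs; rewrite normrM normfV (gtr0_norm (t_gt0 j)) ler_pdivrMr//.
  apply: le_trans (hM _ _) _; rewrite -mulrA ler_pM2l// enormZ ?(ltW (t_gt0 j))//.
  rewrite mulrDl mul1r lerD// mulrC ler_pM2r//.
  exact: le_trans (ler_norm _) (vK s Qs).
have Nd0 : 0 < N%:R ^+ d :> R by rewrite exprn_gt0// ltr0n.
have le_f j : ((N%:R ^+ d * a)%:E <= \int[leb R d]_(s in cube (c N) N) (f j s)%:E)%E.
  rewrite EFinM -lee_pdivlMl//; apply: ltW; apply: lt_le_trans (tP j).2 _.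
  exact: Ahom_rescaled_le.
rewrite lee_pdivlMl// -EFinM.
apply: (@le_trans _ _ (limn_esup
    (fun j => \int[leb R d]_(s in cube (c N) N) (f j s)%:E)%E)).
  apply: le_ereal_inf_tmp => _ [V oV <-]; have [j Vj] := filter_ex oV.
  by apply: le_trans (le_f j) (ereal_sup_ubound _); exists j.
apply: le_trans (reverse_fatou _ _ _ (leb R d) _ f _ _ _ mf _ fC) _.
- exact: measurable_cube.
- exact: leb_cube_lty.
- by rewrite mulr_ge0 ?addr_ge0// ltW.
apply: le_integral_pointwise => s _.
apply: (limn_esup_comp_le _ _ _ (fun p : 'rV[R]_d * R => (h p.1 (p.2 *: _) / p.2)%:E)
  _ (fun j => (rV_of_tuple s, t j))).
exact: (cvg_pair (cvg_cst _) t_oo).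
Unshelve. all: by end_near. Qed.
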